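(* Let $\kappa_i=1$ for all $i\in[N]$. Every $(x,r,s)\in\mathbb{R}^n\times\mathbb{R}^N\times\mathbb{R}$ that satisfies the FICA constraints (F1)–(F6) defined in the context also satisfies the CVaR constraints (C1)–(C3) defined in the context (with the same $x$, $r$, $s$).
   Context: Notation: $[m]=\{1,\dots,m\}$ for a positive integer $m$. Let $N,P,K,n\ge 1$ be integers, $\epsilon\in(0,1)$ a risk level, $\theta\ge 0$ a Wasserstein radius, and $k=\lfloor \epsilon N\rfloor$. Let $\|\cdot\|$ be a norm on $\mathbb{R}^K$ with dual norm $\|\cdot\|_*$. Let $\xi_1,\dots,\xi_N\in\mathbb{R}^K$ be data samples. For each $p\in[P]$ let $b_p\in\mathbb{R}^K$, $A_p\in\mathbb{R}^{n\times K}$, $d_p\in\mathbb{R}$, $a_p\in\mathbb{R}^n$ be given; the decision vector is $x\in\mathbb{R}^n$ (so $b_p-A_p^\top x\in\mathbb{R}^K$). One-dimensional structure: the random vector $\xi$ has coordinates $e_{t,w}$, $t\in[T]$, $w\in\mathcal{W}$ (a finite set), so $K=T|\mathcal{W}|$, and among the coordinates of $x$ are variables $\alpha_{t,g}$, $t\in[T]$, $g\in\mathcal{G}$ (a finite set). A subset $[P]^*\subseteq[P]$ is given such that for each $p\in[P]^*$ there are $t\in[T]$, $g\in\mathcal{G}$ and a sign $\sigma_p\in\{+1,-1\}$ with $$(b_p-A_p^\top x)^\top\xi=\sigma_p\,\alpha_{t,g}\sum_{w\in\mathcal{W}}e_{t,w}\qquad\text{for all }x\in\mathbb{R}^n,\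 \xi\in\mathbb{R}^K.$$ Ordering: for each $p\in[P]^*$ let $\pi_p$ be a permutation of $[N]$ such that, with $\mathbf{1}\in\mathbb{R}^n$ the all-ones vector, $(b_p-A_p^\top\mathbf{1})^\top\xi_{\pi_p(1)}\le\cdots\le(b_p-A_p^\top\mathbf{1})^\top\xi_{\pi_p(N)}$. Define $[N]_p=\{\pi_p(1),\dots,\pi_p(k)\}\cup\{\pi_p(N-k+1),\dots,\pi_p(N)\}$. FICA constraints on $(x,r,s)$, with $r=(r_i)_{i\in[N]}$ and hyperparameters $\kappa_i$: (F1) $s\ge0$ and $r_i\ge0$ for all $i\in[N]$; (F2) $\epsilon N s-\sum_{i\in[N]}r_i\ge\theta N\max_{p\in[P]}\|b_p-A_p^\top x\|_*$; (F3) $\kappa_i\big((b_p-A_p^\top x)^\top\xi_i+d_p-a_p^\top x\big)\ge s-r_i$ for all $p\in[P]^*$, $i\in[N]_p$; (F4) $\kappa_i\big((b_p-A_p^\top x)^\top\xi_i+d_p-a_p^\top x\big)\ge s-r_i$ for all $p\in[P]\setminus[P]^*$, $i\in[N]$; (F5) $(b_p-A_p^\top x)^\top\xi_{\pi_p(k+1)}+d_p-a_p^\top x\ge s$ for all $p\in[P]^*$; (F6) $(b_p-A_p^\top x)^\top\xi_{\pi_p(N-k)}+d_p-a_p^\top x\ge s$ for all $p\in[P]^*$. CVaR constraints on $(x,r,s)$: (C1) $r_i\ge0$ for all $i\in[N]$ and $s\ge0$; (C2) $\epsilon N s-\sum_{i\in[N]}r_i\ge\theta N\max_{p\in[P]}\|b_p-A_p^\top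 x\|_*$; (C3) $(b_p-A_p^\top x)^\top\xi_i-a_p^\top x+d_p\ge s-r_i$ for all $i\in[N]$, $p\in[P]$. *)

(* Defs.v *)
From HB Require Import structures.
From mathcomp Require Import all_boot all_order all_algebra all_fingroup.
From mathcomp Require Import boolp classical_sets reals.

Set Implicit Arguments.
Unset Strict Implicit.
Unset Printing Implicit Defensive.

Import Order.TTheory GRing.Theory Num.Theory.

Local Open Scope ring_scope.

Definition dotv (R : realType) (m : nat) (u v : 'cV[R]_m) : R :=
  (u^T *m v) 0 0.

(* An arbitrary norm on column vectors; the library's norm structures would
   impose one fixed norm on this type. *)
Record is_norm (R : realType) (m : nat) (nrm : 'cV[R]_m -> R) : Prop := IsNorm {
  norm_eq0 : forall v, nrm v = 0 -> v = 0;
  norm_scale : forall (c : R) v, nrm (c *: v) = `|c| * nrm v;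
  norm_triangle : forall u v, nrm (u + v) <= nrm u + nrm v }.

Definition dual_norm (R : realType) (m : nat) (nrm : 'cV[R]_m -> R)
    (y : 'cV[R]_m) : R :=
  sup [set dotv y v | v in [set v | nrm v <= 1]]%classic.

Lemma dual_norm_ge0 (R : realType) (m : nat) (nrm : 'cV[R]_m -> R)
  (y : 'cV[R]_m) : is_norm nrm -> 0 <= dual_norm nrm y.
Proof.
move=> hn; rewrite /dual_norm; set E := (X in sup X).
have [hE|hE] := pselect (has_sup E); last by rewrite sup_out.
apply: sup_upper_bound => //; exists 0; last by rewrite /dotv mulmx0 mxE.
by rewrite /= -(scale0r 0) (norm_scale hn) normr0 mul0r ler01.
Qed.

Definition slope (R : realType) (K n : nat) (b : 'cV[R]_K) (A : 'M[R]_(n, K))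
    (x : 'cV[R]_n) : 'cV[R]_K := b - A^T *m x.

(* The base value 0 does not affect the maximum when P > 0, by dual_norm_ge0. *)
Definition max_dual_norm (R : realType) (P K n : nat) (nrm : 'cV[R]_K -> R)
    (b : 'I_P -> 'cV[R]_K) (A : 'I_P -> 'M[R]_(n, K)) (x : 'cV[R]_n) : R :=
  \big[Num.max/0]_(p < P) dual_norm nrm (slope (b p) (A p) x).

Definition cutoff (R : realType) (eps : R) (N : nat) : nat :=
  Num.truncn (eps * N%:R).

Lemma cutoff_lt (R : realType) (eps : R) (N : nat) :
  0 < eps < 1 -> (0 < N)%N -> (cutoff eps N < N)%N.
Proof.
move=> /andP[e0 e1] N0; rewrite /cutoff truncn_lt_nat.
  by rewrite -[ltRHS]mul1r ltr_pM2r // ltr0n.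
by rewrite mulr_ge0 // ltW.
Qed.

(* Positions are 0-based: [pi j] is the sample of rank j + 1, so the lowest k
   ranks are j < k and the highest k ranks are N - k <= j. *)
Definition extreme_samples (N k : nat) (pi : {perm 'I_N}) : {set 'I_N} :=
  [set pi j | j : 'I_N & (j < k)%N] :|: [set pi j | j : 'I_N & (N - k <= j)%N].

(* [alpha] and [e] locate the scalar variables alpha_{t,g} and e_{t,w} among the
   coordinates of x and of xi. *)
Definition one_dim_structure (R : realType) (P K n T : nat) (W G : finType)
    (alpha : 'I_T * G -> 'I_n) (e : 'I_T * W -> 'I_K)
    (b : 'I_P -> 'cV[R]_K) (A : 'I_P -> 'M[R]_(n, K)) (Pstar : {set 'I_P})
    : Prop :=
  forall p, p \in Pstar ->
    exists (t : 'I_T) (g : G) (sigma : R),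
      (sigma = 1 \/ sigma = -1) /\
      forall (x : 'cV[R]_n) (xi : 'cV[R]_K),
        dotv (slope (b p) (A p) x) xi
        = sigma * x (alpha (t, g)) 0 * \sum_(w : W) xi (e (t, w)) 0.

Definition ordering (R : realType) (N P K n : nat) (xi : 'I_N -> 'cV[R]_K)
    (b : 'I_P -> 'cV[R]_K) (A : 'I_P -> 'M[R]_(n, K)) (Pstar : {set 'I_P})
    (pi : 'I_P -> {perm 'I_N}) : Prop :=
  forall p, p \in Pstar -> forall i j : 'I_N, (i <= j)%N ->
    dotv (slope (b p) (A p) (const_mx 1)) (xi (pi p i))
    <= dotv (slope (b p) (A p) (const_mx 1)) (xi (pi p j)).

(* In 0-based positions the ranks k + 1 and N - k are [Ordinal ltkN] and
   [rev_ord (Ordinal ltkN)], whose values are k and N - k.+1. *)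
Record FICA (R : realType) (N P K n : nat) (nrm : 'cV[R]_K -> R)
    (eps theta : R) (xi : 'I_N -> 'cV[R]_K)
    (b : 'I_P -> 'cV[R]_K) (A : 'I_P -> 'M[R]_(n, K))
    (d : 'I_P -> R) (a : 'I_P -> 'cV[R]_n)
    (Pstar : {set 'I_P}) (pi : 'I_P -> {perm 'I_N}) (kappa : 'I_N -> R)
    (k : nat) (ltkN : (k < N)%N)
    (x : 'cV[R]_n) (r : 'cV[R]_N) (s : R) : Prop := MkFICA {
  fica_nonneg : 0 <= s /\ forall i : 'I_N, 0 <= r i 0;
  fica_budget :
    eps * N%:R * s - \sum_(i < N) r i 0
    >= theta * N%:R * max_dual_norm nrm b A x;
  fica_star : forall p, p \in Pstar -> forall i, i \in extreme_samples k (pi p) ->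
    kappa i * (dotv (slope (b p) (A p) x) (xi i) + d p - dotv (a p) x)
    >= s - r i 0;
  fica_nonstar : forall p, p \notin Pstar -> forall i : 'I_N,
    kappa i * (dotv (slope (b p) (A p) x) (xi i) + d p - dotv (a p) x)
    >= s - r i 0;
  fica_low : forall p, p \in Pstar ->
    dotv (slope (b p) (A p) x) (xi (pi p (Ordinal ltkN)))
      + d p - dotv (a p) x >= s;
  fica_high : forall p, p \in Pstar ->
    dotv (slope (b p) (A p) x) (xi (pi p (rev_ord (Ordinal ltkN))))
      + d p - dotv (a p) x >= s }.

Record CVaR (R : realType) (N P K n : nat) (nrm : 'cV[R]_K -> R)
    (eps theta : R) (xi : 'I_N -> 'cV[R]_K)
    (b : 'I_P -> 'cV[R]_K) (A : 'I_P -> 'M[R]_(n, K))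
    (d : 'I_P -> R) (a : 'I_P -> 'cV[R]_n)
    (x : 'cV[R]_n) (r : 'cV[R]_N) (s : R) : Prop := MkCVaR {
  cvar_nonneg : (forall i : 'I_N, 0 <= r i 0) /\ 0 <= s;
  cvar_budget :
    eps * N%:R * s - \sum_(i < N) r i 0
    >= theta * N%:R * max_dual_norm nrm b A x;
  cvar_scenario : forall (i : 'I_N) (p : 'I_P),
    dotv (slope (b p) (A p) x) (xi i) - dotv (a p) x + d p >= s - r i 0 }.

(* Main.v *)
(* For [p] in [Pstar] the scores of the samples at a decision [x] are a common
   multiple [c] of their scores at the all-ones decision, so the ordering
   [pi p] sorts them for every [x], increasingly or decreasingly with the sign
   of [c].  Hence each sample of rank between [k + 1] and [N - k] scores at least
   as much as one of these two ranks, where the constraint holds with slack [s];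
   the remaining samples are constrained explicitly. *)
Require Import Defs.
From mathcomp Require Import all_boot all_order all_algebra all_fingroup.
From mathcomp Require Import reals.

Set Implicit Arguments.
Unset Strict Implicit.
Unset Printing Implicit Defensive.

Import Order.TTheory GRing.Theory Num.Theory.

Local Open Scope ring_scope.

(** The variable [alpha (t, g)] equals 1 at the all-ones decision, so its value at [x] serves as
    [c]; [sigma] is common to both sides. *)
Lemma one_dim_proportional (R : realType) (P K n T : nat) (W G : finType)
    (alpha : 'I_T * G -> 'I_n) (e : 'I_T * W -> 'I_K)
    (b : 'I_P -> 'cV[R]_K) (A : 'I_P -> 'M[R]_(n, K)) (Pstar : {set 'I_P})
    (p : 'I_P) (x : 'cV[R]_n) :
  one_dim_structure alpha e b A Pstar -> p \in Pstar ->
  exists c : R, forall xi : 'cV[R]_K,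
    dotv (slope (b p) (A p) x) xi
    = c * dotv (slope (b p) (A p) (const_mx 1)) xi.
Proof.
move=> hstruct /hstruct[t [g [sigma [_ dotvE]]]].
exists (x (alpha (t, g)) 0) => xi.
by rewrite !dotvE mxE mulr1 mulrA [X in X * _]mulrC.
Qed.

(** A linear function on an interval is smallest at an endpoint, chosen by the sign of [c]. *)
Lemma scaled_between_ge (R : realDomainType) (c l y u m : R) :
  l <= y -> y <= u -> m <= c * l -> m <= c * u -> m <= c * y.
Proof.
move=> ly yu ml mu; have [c0|/ltW c0] := leP 0 c.
  by apply: le_trans ml _; rewrite ler_wpM2l.
by apply: le_trans mu _; rewrite ler_wnM2l.
Qed.

Lemma non_extreme_rank (N k : nat) (pi : {perm 'I_N}) (j : 'I_N) :
  pi j \notin extreme_samples k pi -> (k <= j < N - k)%N.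
Proof.
rewrite inE negb_or => /andP[lo hi]; apply/andP; split.
  by rewrite leqNgt; apply: contra lo => jk; apply/imsetP; exists j; rewrite ?inE.
by rewrite ltnNge; apply: contra hi => jk; apply/imsetP; exists j; rewrite ?inE.
Qed.

Theorem theorem2 (R : realType) (N P K n T : nat)
  (hN : (0 < N)%N) (hP : (0 < P)%N) (hK : (0 < K)%N) (hn : (0 < n)%N)
  (eps theta : R) (heps : 0 < eps < 1) (htheta : 0 <= theta)
  (nrm : 'cV[R]_K -> R) (hnrm : is_norm nrm)
  (xi : 'I_N -> 'cV[R]_K)
  (b : 'I_P -> 'cV[R]_K) (A : 'I_P -> 'M[R]_(n, K))
  (d : 'I_P -> R) (a : 'I_P -> 'cV[R]_n)
  (W G : finType)
  (alpha : 'I_T * G -> 'I_n) (halpha : injective alpha)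
  (e : 'I_T * W -> 'I_K) (he : bijective e)
  (Pstar : {set 'I_P})
  (hstruct : one_dim_structure alpha e b A Pstar)
  (pi : 'I_P -> {perm 'I_N}) (hpi : ordering xi b A Pstar pi)
  (kappa : 'I_N -> R) (hkappa : forall i : 'I_N, kappa i = 1)
  (x : 'cV[R]_n) (r : 'cV[R]_N) (s : R) :
  FICA nrm eps theta xi b A d a Pstar pi kappa (cutoff_lt heps hN) x r s ->
  CVaR nrm eps theta xi b A d a x r s.
Proof.
move=> [[s0 r0] budget star nonstar low high]; split=> // i p.
rewrite -addrA [- _ + _]addrC addrA.
have [pS|pS] := boolP (p \in Pstar); last first.
  by have := nonstar p pS i; rewrite hkappa mul1r.
have [ext|mid] := boolP (i \in extreme_samples (cutoff eps N) (pi p)).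
  by have := star p pS i ext; rewrite hkappa mul1r.
(* For a middle sample the stronger bound [s] holds, as [r i 0] is nonnegative. *)
apply: (@le_trans _ _ s); first by rewrite lerBlDr lerDl.
move: mid (low p pS) (high p pS).
have [c cE] := one_dim_proportional x hstruct pS.
rewrite -[i](permKV (pi p)); set j := (pi p)^-1%g i => mid.
have /andP[kj jNk] := non_extreme_rank mid.
(* Moving the terms free of the sample to the left gives all three inequalities the same lower
   bound. *)
rewrite !cE -!addrA -!lerBlDr; apply: scaled_between_ge; apply: hpi => //=.
(* The upper rank sits at position [N - k.+1], the last one below [N - k]. *)
by rewrite subnS -ltnS prednK // (leq_ltn_trans _ jNk).
Qed.
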